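(* Let $\mathbb{K}$ be a unital commutative ring, $V$ a $\mathbb{K}$-module, and $x,y\in V$. Put $e(z):=1+\sum_{n\ge 1}z^{\prec n}$ and $e'(z):=1+\sum_{n\ge 1}z^{\succ n}$. Then the following equalities hold in the completed free unital dendriform algebra $\mathbb{K}\,1\oplus Dend(V)^{\wedge}$: $$e(x)\,e(y)=e\big(x+e(x)\succ y\prec e'(-x)\big),$$ $$e'(x)\,e'(y)=e'\big(e(-y)\succ x\prec e'(y)+y\big).$$
   Context: A dendriform algebra over $\mathbb{K}$ is a $\mathbb{K}$-module $A$ with two bilinear operations $\prec,\succ:A\otimes A\to A$ such that $(x\prec y)\prec z=x\prec(y\prec z)+x\prec(y\succ z)$, $(x\succ y)\prec z=x\succ(y\prec z)$, $(x\prec y)\succ z+(x\succ y)\succ z=x\succ(y\succ z)$. The product $xy:=x\prec y+x\succ y$ is associative. $Dend(V)=\bigoplus_{n\ge 1}Dend_n\otimes V^{\otimes n}$ is the free dendriform algebra on $V$, graded by degree $n$, and $Dend(V)^{\wedge}=\prod_{n\ge 1}Dend_n\otimes V^{\otimes n}$ is its completion, to which the operations extend. A unit $1$ is adjoined by $u\prec 1=u$, $1\prec u=0$, $u\succ 1=0$, $1\succ u=u$ for $u\in Dend(V)^{\wedge}$, while $1\prec1$ and $1\succ 1$ are not defined; the associative product is extended so that $1$ is a two-sided unit, e.g. $(1+u)(1+v)=1+u+v+u\prec v+u\succ v$. For $z\in Dend(V)^{\wedge}$: $z^{\prec 1}=z$, $z^{\prec n}=z\prec(z^{\prec n-1})$;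 $z^{\succ 1}=z$, $z^{\succ n}=(z^{\succ n-1})\succ z$; the infinite sums converge degreewise. An expression $a\succ z\prec b$ means $(a\succ z)\prec b=a\succ(z\prec b)$, where $a,b$ may have constant term and the unit rules apply; e.g. $e(x)\succ y\prec e'(-x)=\sum_{i,j\ge0}(-1)^j x^{\prec i}\succ y\prec x^{\succ j}$ with $x^{\prec 0}=x^{\succ 0}=1$. *)

(* Defs.v *)
From HB Require Import structures.
From mathcomp Require Import all_boot all_order all_algebra.
From mathcomp Require Import generic_quotient.
From mathcomp Require Import boolp.
Set Implicit Arguments.
Unset Strict Implicit.
Unset Printing Implicit Defensive.
Import GRing.Theory.
Local Open Scope ring_scope.
Local Open Scope quotient_scope.

Reserved Notation "x ≺ y" (at level 40, left associativity).
Reserved Notation "x ≻ y" (at level 40, left associativity).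

Lemma linear_fun0 (K : pzRingType) (U W : lmodType K) (f : U -> W) :
  linear f -> f 0 = 0.
Proof. by move=> fL; have := fL (-1) 0 0; rewrite scaler0 addr0 scaleN1r addNr. Qed.
Lemma linear_funN (K : pzRingType) (U W : lmodType K) (f : U -> W) u :
  linear f -> f (- u) = - f u.
Proof.
by move=> fL; have := fL (-1) u 0; rewrite !scaleN1r !(linear_fun0 fL) !addr0.
Qed.

HB.mixin Record Lmodule_isDendriform (K : comPzRingType) A
    of GRing.Lmodule K A := {
  dprec : A -> A -> A;
  dsucc : A -> A -> A;
  dprec_linearl : forall z : A, linear (dprec^~ z);
  dprec_linearr : forall z : A, linear (dprec z);
  dsucc_linearl : forall z : A, linear (dsucc^~ z);
  dsucc_linearr : forall z : A, linear (dsucc z);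
  dprecA : forall x y z : A,
    dprec (dprec x y) z = dprec x (dprec y z) + dprec x (dsucc y z);
  dsucc_precA : forall x y z : A,
    dprec (dsucc x y) z = dsucc x (dprec y z);
  dsuccA : forall x y z : A,
    dsucc (dprec x y) z + dsucc (dsucc x y) z = dsucc x (dsucc y z)
}.

#[short(type="dendriformType")]
HB.structure Definition Dendriform (K : comPzRingType) :=
  {A of Lmodule_isDendriform K A & GRing.Lmodule K A}.

Notation "x ≺ y" := (dprec x y) : ring_scope.
Notation "x ≻ y" := (dsucc x y) : ring_scope.

Section DendriformTheory.
Variables (K : comPzRingType) (A : dendriformType K).
Implicit Types x y z : A.

Lemma dprecDl x y z : (x + y) ≺ z = x ≺ z + y ≺ z.
Proof. by have := dprec_linearl z 1 x y; rewrite /= !scale1r. Qed.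
Lemma dprecDr z x y : z ≺ (x + y) = z ≺ x + z ≺ y.
Proof. by have := dprec_linearr z 1 x y; rewrite /= !scale1r. Qed.
Lemma dsuccDl x y z : (x + y) ≻ z = x ≻ z + y ≻ z.
Proof. by have := dsucc_linearl z 1 x y; rewrite /= !scale1r. Qed.
Lemma dsuccDr z x y : z ≻ (x + y) = z ≻ x + z ≻ y.
Proof. by have := dsucc_linearr z 1 x y; rewrite /= !scale1r. Qed.
Lemma dprec0l z : 0 ≺ z = 0.
Proof. by apply: (addrI (0 ≺ z)); rewrite -dprecDl !addr0. Qed.
Lemma dprec0r z : z ≺ 0 = 0.
Proof. by apply: (addrI (z ≺ 0)); rewrite -dprecDr !addr0. Qed.
Lemma dsucc0l z : 0 ≻ z = 0.
Proof. by apply: (addrI (0 ≻ z)); rewrite -dsuccDl !addr0. Qed.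
Lemma dsucc0r z : z ≻ 0 = 0.
Proof. by apply: (addrI (z ≻ 0)); rewrite -dsuccDr !addr0. Qed.
Lemma dprecZl a x z : (a *: x) ≺ z = a *: (x ≺ z).
Proof. by have := dprec_linearl z a x 0; rewrite /= !addr0 dprec0l addr0. Qed.
Lemma dprecZr a z x : z ≺ (a *: x) = a *: (z ≺ x).
Proof. by have := dprec_linearr z a x 0; rewrite /= !addr0 dprec0r addr0. Qed.
Lemma dsuccZl a x z : (a *: x) ≻ z = a *: (x ≻ z).
Proof. by have := dsucc_linearl z a x 0; rewrite /= !addr0 dsucc0l addr0. Qed.
Lemma dsuccZr a z x : z ≻ (a *: x) = a *: (z ≻ x).
Proof. by have := dsucc_linearr z a x 0; rewrite /= !addr0 dsucc0r addr0. Qed.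

Lemma dprec_suml n (F : nat -> A) z :
  (\sum_(i < n) F i) ≺ z = \sum_(i < n) F i ≺ z.
Proof.
by elim: n => [|n IH]; rewrite ?big_ord0 ?dprec0l // !big_ord_recr /= dprecDl IH.
Qed.
Lemma dprec_sumr n (F : nat -> A) z :
  z ≺ (\sum_(i < n) F i) = \sum_(i < n) z ≺ F i.
Proof.
by elim: n => [|n IH]; rewrite ?big_ord0 ?dprec0r // !big_ord_recr /= dprecDr IH.
Qed.
Lemma dsucc_suml n (F : nat -> A) z :
  (\sum_(i < n) F i) ≻ z = \sum_(i < n) F i ≻ z.
Proof.
by elim: n => [|n IH]; rewrite ?big_ord0 ?dsucc0l // !big_ord_recr /= dsuccDl IH.
Qed.
Lemma dsucc_sumr n (F : nat -> A) z :
  z ≻ (\sum_(i < n) F i) = \sum_(i < n) z ≻ F i.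
Proof.
by elim: n => [|n IH]; rewrite ?big_ord0 ?dsucc0r // !big_ord_recr /= dsuccDr IH.
Qed.

Definition dmul x y : A := x ≺ y + x ≻ y.

Lemma dmulDl : left_distributive dmul +%R.
Proof. by move=> x y z; rewrite /dmul dprecDl dsuccDl addrACA. Qed.
Lemma dmulDr : right_distributive dmul +%R.
Proof. by move=> x y z; rewrite /dmul dprecDr dsuccDr addrACA. Qed.
Lemma dmulZl a x y : dmul (a *: x) y = a *: dmul x y.
Proof. by rewrite /dmul dprecZl dsuccZl scalerDr. Qed.
Lemma dmulZr a x y : dmul x (a *: y) = a *: dmul x y.
Proof. by rewrite /dmul dprecZr dsuccZr scalerDr. Qed.
Lemma dmul0l : left_zero 0 dmul.
Proof. by move=> x; rewrite /dmul dprec0l dsucc0l addr0. Qed.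
Lemma dmul0r : right_zero 0 dmul.
Proof. by move=> x; rewrite /dmul dprec0r dsucc0r addr0. Qed.

Lemma dmulA : associative dmul.
Proof.
move=> x y z; rewrite /dmul !dprecDr !dsuccDr !dprecDl !dsuccDl.
by rewrite dprecA dsucc_precA -dsuccA !addrA.
Qed.
End DendriformTheory.

(* The free dendriform algebra on V: formal expressions in the elements of V  *)
(* modulo the congruence generated by the module axioms, the linearity of     *)
(* V -> Dend(V), bilinearity and the dendriform axioms. Its universal         *)
(* property is dend_lift / dend_lift_unique below.                            *)
Section FreeDendriform.
Variables (K : comPzRingType) (V : lmodType K).

Inductive dterm :=
  | TGen of V
  | TZero
  | TOpp of dterm
  | TAdd of dterm & dterm
  | TScale of K & dterm
  | TPrec of dterm & dterm
  | TSucc of dterm & dterm.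

Inductive dcong : dterm -> dterm -> Prop :=
  | cong_refl s : dcong s s
  | cong_sym s t : dcong s t -> dcong t s
  | cong_trans s t u : dcong s t -> dcong t u -> dcong s u
  | cong_opp s s' : dcong s s' -> dcong (TOpp s) (TOpp s')
  | cong_add s s' t t' :
      dcong s s' -> dcong t t' -> dcong (TAdd s t) (TAdd s' t')
  | cong_scale a s s' : dcong s s' -> dcong (TScale a s) (TScale a s')
  | cong_prec s s' t t' :
      dcong s s' -> dcong t t' -> dcong (TPrec s t) (TPrec s' t')
  | cong_succ s s' t t' :
      dcong s s' -> dcong t t' -> dcong (TSucc s t) (TSucc s' t')
  | cong_addA s t u : dcong (TAdd s (TAdd t u)) (TAdd (TAdd s t) u)
  | cong_addC s t : dcong (TAdd s t) (TAdd t s)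
  | cong_add0 s : dcong (TAdd TZero s) s
  | cong_addN s : dcong (TAdd (TOpp s) s) TZero
  | cong_scaleA a b s : dcong (TScale a (TScale b s)) (TScale (a * b) s)
  | cong_scale1 s : dcong (TScale 1 s) s
  | cong_scaleDr a s t :
      dcong (TScale a (TAdd s t)) (TAdd (TScale a s) (TScale a t))
  | cong_scaleDl a b s :
      dcong (TScale (a + b) s) (TAdd (TScale a s) (TScale b s))
  | cong_gen a v w :
      dcong (TGen (a *: v + w)) (TAdd (TScale a (TGen v)) (TGen w))
  | cong_prec_linl a s t u :
      dcong (TPrec (TAdd (TScale a s) t) u)
            (TAdd (TScale a (TPrec s u)) (TPrec t u))
  | cong_prec_linr a s t u :
      dcong (TPrec u (TAdd (TScale a s) t))
            (TAdd (TScale a (TPrec u s)) (TPrec u t))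
  | cong_succ_linl a s t u :
      dcong (TSucc (TAdd (TScale a s) t) u)
            (TAdd (TScale a (TSucc s u)) (TSucc t u))
  | cong_succ_linr a s t u :
      dcong (TSucc u (TAdd (TScale a s) t))
            (TAdd (TScale a (TSucc u s)) (TSucc u t))
  | cong_precA s t u :
      dcong (TPrec (TPrec s t) u) (TAdd (TPrec s (TPrec t u)) (TPrec s (TSucc t u)))
  | cong_succ_precA s t u :
      dcong (TPrec (TSucc s t) u) (TSucc s (TPrec t u))
  | cong_succA s t u :
      dcong (TAdd (TSucc (TPrec s t) u) (TSucc (TSucc s t) u))
            (TSucc s (TSucc t u)).

HB.instance Definition _ := gen_eqMixin dterm.
HB.instance Definition _ := gen_choiceMixin dterm.

Definition dcongb (s t : dterm) : bool := `[< dcong s t >].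

Lemma dcongb_equiv : equiv_class_of dcongb.
Proof.
split=> [s|s t|s t u]; first exact/asboolP/cong_refl.
  by apply/asboolP/asboolP => /cong_sym.
by move=> /asboolP st /asboolP tu; apply/asboolP; apply: cong_trans st tu.
Qed.

Canonical dcong_equiv := EquivRelPack dcongb_equiv.

Definition dend := {eq_quot dcong_equiv}.
HB.instance Definition _ := Choice.on dend.
HB.instance Definition _ := Quotient.on dend.

Lemma dend_eq (s t : dterm) : reflect (dcong s t) (\pi_dend s == \pi_dend t).
Proof. by rewrite piE; apply: asboolP. Qed.

Lemma dend_eqE (s t : dterm) : dcong s t -> \pi_dend s = \pi_dend t.
Proof. by move=> st; apply/eqP/dend_eq. Qed.

Lemma cong_repr (s : dterm) : dcong (repr (\pi_dend s)) s.
Proof. by apply/dend_eq; rewrite reprK. Qed.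

Definition dgen (v : V) : dend := \pi_dend (TGen v).
Definition dzero : dend := \pi_dend TZero.
Definition dopp (a : dend) : dend := \pi_dend (TOpp (repr a)).
Definition dadd (a b : dend) : dend := \pi_dend (TAdd (repr a) (repr b)).
Definition dscale k (a : dend) : dend := \pi_dend (TScale k (repr a)).
Definition dend_prec (a b : dend) : dend := \pi_dend (TPrec (repr a) (repr b)).
Definition dend_succ (a b : dend) : dend := \pi_dend (TSucc (repr a) (repr b)).

Lemma pi_opp s : dopp (\pi_dend s) = \pi_dend (TOpp s).
Proof. by apply/dend_eqE/cong_opp/cong_repr. Qed.
Lemma pi_add s t : dadd (\pi_dend s) (\pi_dend t) = \pi_dend (TAdd s t).
Proof. by apply/dend_eqE/cong_add; apply: cong_repr. Qed.
Lemma pi_scale k s : dscale k (\pi_dend s) = \pi_dend (TScale k s).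
Proof. by apply/dend_eqE/cong_scale/cong_repr. Qed.
Lemma pi_prec s t : dend_prec (\pi_dend s) (\pi_dend t) = \pi_dend (TPrec s t).
Proof. by apply/dend_eqE/cong_prec; apply: cong_repr. Qed.
Lemma pi_succ s t : dend_succ (\pi_dend s) (\pi_dend t) = \pi_dend (TSucc s t).
Proof. by apply/dend_eqE/cong_succ; apply: cong_repr. Qed.

Fact daddA : associative dadd.
Proof.
elim/quotW=> s; elim/quotW=> t; elim/quotW=> u.
rewrite (pi_add t u) (pi_add s t) !pi_add.
by apply/dend_eqE/cong_addA.
Qed.
Fact daddC : commutative dadd.
Proof. by elim/quotW=> s; elim/quotW=> t; rewrite !pi_add; apply/dend_eqE/cong_addC. Qed.
Fact dadd0 : left_id dzero dadd.
Proof. by elim/quotW=> s; rewrite pi_add; apply/dend_eqE/cong_add0. Qed.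
Fact daddN : left_inverse dzero dopp dadd.
Proof. by elim/quotW=> s; rewrite pi_opp pi_add; apply/dend_eqE/cong_addN. Qed.
HB.instance Definition _ := GRing.isZmodule.Build dend daddA daddC dadd0 daddN.
Lemma piD s t : \pi_dend s + \pi_dend t = \pi_dend (TAdd s t).
Proof. exact: pi_add. Qed.

Fact dscaleA a b s : dscale a (dscale b s) = dscale (a * b) s.
Proof. by elim/quotW: s => s; rewrite (pi_scale b s) !pi_scale; apply/dend_eqE/cong_scaleA. Qed.
Fact dscale1 : left_id 1 dscale.
Proof. by elim/quotW=> s; rewrite pi_scale; apply/dend_eqE/cong_scale1. Qed.
Fact dscaleDr : right_distributive dscale +%R.
Proof.
move=> a; elim/quotW=> s; elim/quotW=> t.
by rewrite piD !pi_scale piD; apply/dend_eqE/cong_scaleDr.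
Qed.
Fact dscaleDl s : {morph dscale^~ s : a b / a + b}.
Proof.
elim/quotW: s => s a b.
rewrite /= !pi_scale piD.
by apply/dend_eqE/cong_scaleDl.
Qed.
HB.instance Definition _ :=
  GRing.Zmodule_isLmodule.Build K dend dscaleA dscale1 dscaleDr dscaleDl.
Lemma piZ k s : k *: \pi_dend s = \pi_dend (TScale k s).
Proof. exact: pi_scale. Qed.

Fact dend_prec_linl u : linear (dend_prec^~ u).
Proof.
elim/quotW: u => u a; elim/quotW=> s; elim/quotW=> t.
by rewrite /= piZ piD !pi_prec piZ piD; apply/dend_eqE/cong_prec_linl.
Qed.
Fact dend_prec_linr u : linear (dend_prec u).
Proof.
elim/quotW: u => u a; elim/quotW=> s; elim/quotW=> t.
by rewrite /= piZ piD !pi_prec piZ piD; apply/dend_eqE/cong_prec_linr.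
Qed.
Fact dend_succ_linl u : linear (dend_succ^~ u).
Proof.
elim/quotW: u => u a; elim/quotW=> s; elim/quotW=> t.
by rewrite /= piZ piD !pi_succ piZ piD; apply/dend_eqE/cong_succ_linl.
Qed.
Fact dend_succ_linr u : linear (dend_succ u).
Proof.
elim/quotW: u => u a; elim/quotW=> s; elim/quotW=> t.
by rewrite /= piZ piD !pi_succ piZ piD; apply/dend_eqE/cong_succ_linr.
Qed.
Fact dend_precA x y z : dend_prec (dend_prec x y) z =
  dend_prec x (dend_prec y z) + dend_prec x (dend_succ y z).
Proof.
elim/quotW: x => s; elim/quotW: y => t; elim/quotW: z => u.
by rewrite (pi_prec s t) (pi_prec t u) (pi_succ t u) !pi_prec piD; apply/dend_eqE/cong_precA.
Qed.
Fact dend_succ_precA x y z :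
  dend_prec (dend_succ x y) z = dend_succ x (dend_prec y z).
Proof.
elim/quotW: x => s; elim/quotW: y => t; elim/quotW: z => u.
by rewrite (pi_succ s t) (pi_prec t u) pi_prec pi_succ; apply/dend_eqE/cong_succ_precA.
Qed.
Fact dend_succA x y z :
  dend_succ (dend_prec x y) z + dend_succ (dend_succ x y) z =
  dend_succ x (dend_succ y z).
Proof.
elim/quotW: x => s; elim/quotW: y => t; elim/quotW: z => u.
by rewrite (pi_prec s t) (pi_succ s t) (pi_succ t u) !pi_succ piD; apply/dend_eqE/cong_succA.
Qed.
HB.instance Definition _ := Lmodule_isDendriform.Build K dend
  dend_prec_linl dend_prec_linr dend_succ_linl dend_succ_linr
  dend_precA dend_succ_precA dend_succA.

Lemma dgen_linear : linear dgen.
Proof.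
by move=> a v w; rewrite piZ piD; apply/dend_eqE/cong_gen.
Qed.

(* The component Dend_n ⊗ V^{⊗n} of degree n: the submodule spanned by the    *)
(* monomials in n elements of V.                                              *)
Inductive homog : nat -> dend -> Prop :=
  | homog_gen v : homog 1 (dgen v)
  | homog0 n : homog n 0
  | homogD n a b : homog n a -> homog n b -> homog n (a + b)
  | homogZ n k a : homog n a -> homog n (k *: a)
  | homog_prec m n a b : homog m a -> homog n b -> homog (m + n) (a ≺ b)
  | homog_succ m n a b : homog m a -> homog n b -> homog (m + n) (a ≻ b).

Lemma homog_deg0 a : homog 0 a -> a = 0.
Proof.
suff H n b : homog n b -> n = 0%N -> b = 0 by move=> /H; apply.
elim=> // {a n b}.
- by move=> n a b _ IHa _ IHb n0; rewrite IHa // IHb // addr0.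
- by move=> n k a _ IHa n0; rewrite IHa // scaler0.
- move=> m n a b _ IHa _ IHb /eqP; rewrite addn_eq0 => /andP[/eqP m0 _].
  by rewrite IHa // dprec0l.
- move=> m n a b _ IHa _ IHb /eqP; rewrite addn_eq0 => /andP[/eqP m0 _].
  by rewrite IHa // dsucc0l.
Qed.

Lemma homog_sum n m (F : nat -> dend) :
  (forall i, (i < m)%N -> homog n (F i)) -> homog n (\sum_(i < m) F i).
Proof.
elim: m => [|m IH] hF; first by rewrite big_ord0; apply: homog0.
rewrite big_ord_recr /=; apply: homogD; last exact: hF.
by apply: IH => i im; apply: hF; rewrite ltnW.
Qed.

(* The completion: families (a_n) with a_n of degree n, so that a_0 = 0       *)
(* by homog_deg0.                                                             *)
Record cdend := CDend { comp :> nat -> dend; compP : forall n, homog n (comp n) }.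

Lemma cdendP (u v : cdend) : (forall n, u n = v n) -> u = v.
Proof.
case: u v => [u hu] [v hv] /= /funext uv; case: _ / uv in hv *.
by congr CDend; apply: Prop_irrelevance.
Qed.

HB.instance Definition _ := gen_eqMixin cdend.
HB.instance Definition _ := gen_choiceMixin cdend.

Definition czero := CDend (fun n => homog0 n).
Definition cadd (u v : cdend) :=
  CDend (fun n => homogD (compP u n) (compP v n)).
Definition cscale k (u : cdend) := CDend (fun n => homogZ k (compP u n)).
Definition copp (u : cdend) := cscale (-1) u.

Fact caddA : associative cadd.
Proof. by move=> u v w; apply: cdendP => n; apply: addrA. Qed.
Fact caddC : commutative cadd.
Proof. by move=> u v; apply: cdendP => n; apply: addrC. Qed.
Fact cadd0 : left_id czero cadd.
Proof. by move=> u; apply: cdendP => n; apply: add0r. Qed.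
Fact caddN : left_inverse czero copp cadd.
Proof. by move=> u; apply: cdendP => n /=; rewrite scaleN1r addNr. Qed.
HB.instance Definition _ := GRing.isZmodule.Build cdend caddA caddC cadd0 caddN.

Fact cscaleA a b s : cscale a (cscale b s) = cscale (a * b) s.
Proof. by apply: cdendP => n; apply: scalerA. Qed.
Fact cscale1 : left_id 1 cscale.
Proof. by move=> u; apply: cdendP => n; apply: scale1r. Qed.
Fact cscaleDr : right_distributive cscale +%R.
Proof. by move=> a u v; apply: cdendP => n; apply: scalerDr. Qed.
Fact cscaleDl s : {morph cscale^~ s : a b / a + b}.
Proof. by move=> a b; apply: cdendP => n; apply: scalerDl. Qed.
HB.instance Definition _ :=
  GRing.Zmodule_isLmodule.Build K cdend cscaleA cscale1 cscaleDr cscaleDl.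

Lemma homog_cprec (u v : cdend) n :
  homog n (\sum_(i < n.+1) u i ≺ v (n - i)%N).
Proof.
apply: (homog_sum (F := fun i => u i ≺ v (n - i)%N)) => i; rewrite ltnS => le_in.
by rewrite -[X in homog X](subnKC le_in); apply: homog_prec; apply: compP.
Qed.
Lemma homog_csucc (u v : cdend) n :
  homog n (\sum_(i < n.+1) u i ≻ v (n - i)%N).
Proof.
apply: (homog_sum (F := fun i => u i ≻ v (n - i)%N)) => i; rewrite ltnS => le_in.
by rewrite -[X in homog X](subnKC le_in); apply: homog_succ; apply: compP.
Qed.
Definition cprec (u v : cdend) := CDend (homog_cprec u v).
Definition csucc (u v : cdend) := CDend (homog_csucc u v).

Lemma sum_triangle (F : nat -> nat -> nat -> dend) n :
  \sum_(i < n.+1) \sum_(j < i.+1) F j (i - j)%N (n - i)%N =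
  \sum_(j < n.+1) \sum_(k < (n - j).+1) F j k (n - j - k)%N.
Proof.
transitivity (\sum_(i < n.+1) \sum_(j < n.+1 | (j < i.+1)%N)
                F j (i - j)%N (n - i)%N).
  apply: eq_bigr => i _.
  by rewrite (big_ord_widen n.+1 (fun j => F j (i - j)%N (n - i)%N)) ?ltnS // -ltnS.
rewrite (exchange_big_dep xpredT) //=; apply: eq_bigr => j _.
have le_jn : (j <= n)%N by rewrite -ltnS.
rewrite -(big_mkord (fun i => (j < i.+1)%N) (fun i => F j (i - j)%N (n - i)%N)).
rewrite -(big_mkord xpredT (fun k => F j k (n - j - k)%N)).
rewrite -(big_nat_widenl j 0 n.+1 xpredT) //.
rewrite -{1}[nat_of_ord j]add0n big_addn subSn //.
by apply: eq_bigr => k _; rewrite addnK subnDA subnAC.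
Qed.

Fact cprec_linl u : linear (cprec^~ u).
Proof.
move=> a s t; apply: cdendP => n /=; rewrite scaler_sumr -big_split.
by apply: eq_bigr => i _; rewrite dprecDl dprecZl.
Qed.
Fact cprec_linr u : linear (cprec u).
Proof.
move=> a s t; apply: cdendP => n /=; rewrite scaler_sumr -big_split.
by apply: eq_bigr => i _; rewrite dprecDr dprecZr.
Qed.
Fact csucc_linl u : linear (csucc^~ u).
Proof.
move=> a s t; apply: cdendP => n /=; rewrite scaler_sumr -big_split.
by apply: eq_bigr => i _; rewrite dsuccDl dsuccZl.
Qed.
Fact csucc_linr u : linear (csucc u).
Proof.
move=> a s t; apply: cdendP => n /=; rewrite scaler_sumr -big_split.
by apply: eq_bigr => i _; rewrite dsuccDr dsuccZr.
Qed.
Fact cprecA x y z : cprec (cprec x y) z = cprec x (cprec y z) + cprec x (csucc y z).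
Proof.
apply: cdendP => n /=.
under eq_bigr => i _ do rewrite (dprec_suml _ (fun j => x j ≺ y (i - j)%N)).
rewrite (sum_triangle (fun a b c => (x a ≺ y b) ≺ z c)) -big_split /=.
apply: eq_bigr => j _; rewrite (dprec_sumr _ (fun k => y k ≺ z (n - j - k)%N)).
rewrite (dprec_sumr _ (fun k => y k ≻ z (n - j - k)%N)) -big_split /=.
by apply: eq_bigr => k _; rewrite dprecA.
Qed.
Fact csucc_precA x y z : cprec (csucc x y) z = csucc x (cprec y z).
Proof.
apply: cdendP => n /=.
under eq_bigr => i _ do rewrite (dprec_suml _ (fun j => x j ≻ y (i - j)%N)).
rewrite (sum_triangle (fun a b c => (x a ≻ y b) ≺ z c)) /=.
apply: eq_bigr => j _; rewrite (dsucc_sumr _ (fun k => y k ≺ z (n - j - k)%N)).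
by apply: eq_bigr => k _; rewrite dsucc_precA.
Qed.
Fact csuccA x y z :
  csucc (cprec x y) z + csucc (csucc x y) z = csucc x (csucc y z).
Proof.
apply: cdendP => n /=.
under eq_bigr => i _ do rewrite (dsucc_suml _ (fun j => x j ≺ y (i - j)%N)).
under [X in _ + X]eq_bigr => i _ do
  rewrite (dsucc_suml _ (fun j => x j ≻ y (i - j)%N)).
rewrite (sum_triangle (fun a b c => (x a ≺ y b) ≻ z c)).
rewrite (sum_triangle (fun a b c => (x a ≻ y b) ≻ z c)) -big_split /=.
apply: eq_bigr => j _; rewrite (dsucc_sumr _ (fun k => y k ≻ z (n - j - k)%N)).
rewrite -big_split /=.
by apply: eq_bigr => k _; rewrite dsuccA.
Qed.
HB.instance Definition _ := Lmodule_isDendriform.Build K cdend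
  cprec_linl cprec_linr csucc_linl csucc_linr cprecA csucc_precA csuccA.

Lemma homog_cgen (v : V) n : homog n (if n == 1%N then dgen v else 0).
Proof. by case: eqP => [->|_]; [apply: homog_gen | apply: homog0]. Qed.

Definition cgen (v : V) : cdend := CDend (homog_cgen v).

Lemma cgen_linear : linear cgen.
Proof.
move=> a v w; apply: cdendP => n /=; case: eqP => _; first exact: dgen_linear.
by rewrite scaler0 addr0.
Qed.

End FreeDendriform.

Section UniversalProperty.
Variables (K : comPzRingType) (V : lmodType K) (A : dendriformType K).

Definition dend_hom (B : dendriformType K) (g : B -> A) :=
  [/\ linear g, {morph g : a b / a ≺ b} & {morph g : a b / a ≻ b}].

Fixpoint teval (f : V -> A) (t : dterm V) : A :=
  match t with
  | TGen v => f v
  | TZero => 0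
  | TOpp s => - teval f s
  | TAdd s t => teval f s + teval f t
  | TScale a s => a *: teval f s
  | TPrec s t => teval f s ≺ teval f t
  | TSucc s t => teval f s ≻ teval f t
  end.

Definition dend_lift (f : V -> A) (a : dend V) : A := teval f (repr a).

Lemma teval_cong (f : V -> A) (flin : linear f) s t :
  dcong s t -> teval f s = teval f t.
Proof.
elim=> //= {s t}.
- by move=> s t u _ -> _ ->.
- by move=> s s' _ ->.
- by move=> s s' t t' _ -> _ ->.
- by move=> a s s' _ ->.
- by move=> s s' t t' _ -> _ ->.
- by move=> s s' t t' _ -> _ ->.
- by move=> *; apply: addrA.
- by move=> *; apply: addrC.
- by move=> *; apply: add0r.
- by move=> *; apply: addNr.
- by move=> *; apply: scalerA.
- by move=> *; apply: scale1r.
- by move=> *; apply: scalerDr.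
- by move=> *; apply: scalerDl.
- by move=> *; apply: dprec_linearl.
- by move=> *; apply: dprec_linearr.
- by move=> *; apply: dsucc_linearl.
- by move=> *; apply: dsucc_linearr.
- by move=> *; apply: dprecA.
- by move=> *; apply: dsucc_precA.
- by move=> *; apply: dsuccA.
Qed.

Lemma dend_lift_hom (f : V -> A) : linear f -> dend_hom (dend_lift f).
Proof.
move=> flin; split.
- move=> k a b.
  have D u v : dend_lift f (u + v) = dend_lift f u + dend_lift f v.
    exact: (teval_cong flin (cong_repr (TAdd (repr u) (repr v)))).
  have Z u : dend_lift f (k *: u) = k *: dend_lift f u.
    exact: (teval_cong flin (cong_repr (TScale k (repr u)))).
  by rewrite D Z.
- move=> a b.
  exact: (teval_cong flin (cong_repr (TPrec (repr a) (repr b)))).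
- move=> a b.
  exact: (teval_cong flin (cong_repr (TSucc (repr a) (repr b)))).
Qed.

Lemma dend_lift_gen (f : V -> A) v : linear f -> dend_lift f (dgen v) = f v.
Proof. by move=> flin; apply: (teval_cong flin (cong_repr (TGen v))). Qed.

Lemma dend_lift_unique (g h : dend V -> A) :
  dend_hom g -> dend_hom h -> (forall v, g (dgen v) = h (dgen v)) -> g =1 h.
Proof.
move=> [gL gP gS] [hL hP hS] gh; elim/quotW; elim=> /=.
- exact: gh.
- by rewrite [LHS](linear_fun0 gL) [RHS](linear_fun0 hL).
- move=> s IH.
  by rewrite -pi_opp [LHS](linear_funN _ gL) [RHS](linear_funN _ hL) IH.
- move=> s IHs t IHt; rewrite -pi_add.
  have := gL 1 (\pi_(dend V) s) (\pi_(dend V) t).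
  have := hL 1 (\pi_(dend V) s) (\pi_(dend V) t).
  by rewrite !scale1r IHs IHt => <- ->.
- move=> k s IH; rewrite -pi_scale.
  have := gL k (\pi_(dend V) s) 0; have := hL k (\pi_(dend V) s) 0.
  by rewrite (linear_fun0 gL) (linear_fun0 hL) !addr0 IH => <- ->.
- by move=> s IHs t IHt; rewrite -pi_prec [LHS]gP [RHS]hP IHs IHt.
- by move=> s IHs t IHt; rewrite -pi_succ [LHS]gS [RHS]hS IHs IHt.
Qed.

End UniversalProperty.

(* Dend(V) is the direct sum of its components of degree n.                   *)
Section Grading.
Variables (K : comPzRingType) (V : lmodType K).
Local Notation pr := (dend_lift (@cgen K V)).

Lemma homog_pr N (a0 : dend V) :
  homog N a0 -> forall d, pr a0 d = if d == N then a0 else 0.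
Proof.
have [L P S] := dend_lift_hom (@cgen_linear K V).
have pr0 : pr 0 = 0 := linear_fun0 L.
have prD a b : pr (a + b) = pr a + pr b by have := L 1 a b; rewrite !scale1r.
have prZ k b : pr (k *: b) = k *: pr b by have := L k b 0; rewrite pr0 !addr0.
elim=> {N a0}.
- by move=> v d; rewrite dend_lift_gen //; apply: cgen_linear.
- by move=> n d; rewrite pr0 if_same.
- by move=> n a b _ IHa _ IHb d; rewrite prD /= IHa IHb; case: eqP; rewrite ?addr0.
- by move=> n k a _ IHa d; rewrite prZ /= IHa; case: eqP; rewrite ?scaler0.
- move=> m n a b _ IHa _ IHb d; rewrite P /=.
  under eq_bigr => i _ do rewrite IHa IHb.
  have [->|dmn] := eqVneq d (m + n)%N.
    have lt_m : (m < (m + n).+1)%N by rewrite ltnS leq_addr.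
    rewrite (bigD1 (Ordinal lt_m)) //= addKn !eqxx big1 ?addr0 // => i.
    by rewrite -val_eqE /= => /negPf->; rewrite dprec0l.
  rewrite big1 // => i _; case: eqP => [im|_]; last by rewrite dprec0l.
  case: eqP => [dn|_]; last by rewrite dprec0r.
  by case/eqP: dmn; rewrite -im -dn subnKC // -ltnS.
- move=> m n a b _ IHa _ IHb d; rewrite S /=.
  under eq_bigr => i _ do rewrite IHa IHb.
  have [->|dmn] := eqVneq d (m + n)%N.
    have lt_m : (m < (m + n).+1)%N by rewrite ltnS leq_addr.
    rewrite (bigD1 (Ordinal lt_m)) //= addKn !eqxx big1 ?addr0 // => i.
    by rewrite -val_eqE /= => /negPf->; rewrite dsucc0l.
  rewrite big1 // => i _; case: eqP => [im|_]; last by rewrite dsucc0l.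
  case: eqP => [dn|_]; last by rewrite dsucc0r.
  by case/eqP: dmn; rewrite -im -dn subnKC // -ltnS.
Qed.

Lemma dend_graded (a : dend V) :
  exists N, forall M, (N <= M)%N -> a = \sum_(n < M) pr a n.
Proof.
have [L P S] := dend_lift_hom (@cgen_linear K V).
have pr0 : pr 0 = 0 := linear_fun0 L.
have prD b c : pr (b + c) = pr b + pr c by have := L 1 b c; rewrite !scale1r.
pose hom (b : dend V) := exists n, homog n b.
suff [s [hs ->]] : exists s : seq (dend V),
    (forall b, b \in s -> hom b) /\ a = \sum_(b <- s) b.
  elim: s hs => [|b s IH] hs.
    by exists 0%N => M _; rewrite big_nil pr0 big1.
  have [|N hN] := IH; first by move=> c cs; apply: hs; rewrite inE cs orbT.
  have [n hb] := hs b (mem_head _ _).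
  exists (maxn N n.+1) => M; rewrite geq_max => /andP[NM nM].
  rewrite big_cons prD /= big_split /= -hN //; congr (_ + _).
  rewrite (bigD1 (Ordinal nM)) //= (homog_pr hb) eqxx big1 ?addr0 // => i.
  by rewrite -val_eqE /= (homog_pr hb) => /negPf->.
elim/quotW: a; elim=> /=.
- move=> v; exists [:: dgen v]; rewrite big_seq1; split=> // b.
  by rewrite inE => /eqP->; exists 1%N; apply: homog_gen.
- by exists [::]; rewrite big_nil.
- move=> t [s [hs E]]; exists [seq -1 *: b | b <- s]; split.
    by move=> _ /mapP[b /hs[n hb] ->]; exists n; apply: homogZ.
  by rewrite big_map -scaler_sumr -E scaleN1r; apply/esym; apply: pi_opp.
- move=> t [s [hs E]] t' [s' [hs' E']]; exists (s ++ s'); split.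
    by move=> b; rewrite mem_cat => /orP[/hs|/hs'].
  by rewrite big_cat /= -E -E' piD.
- move=> k t [s [hs E]]; exists [seq k *: b | b <- s]; split.
    by move=> _ /mapP[b /hs[n hb] ->]; exists n; apply: homogZ.
  by rewrite big_map -scaler_sumr -E piZ.
- move=> t [s [hs E]] t' [s' [hs' E']]; exists [seq b ≺ c | b <- s, c <- s']; split.
    move=> _ /allpairsP[[b c] /= [/hs[m hb] /hs'[n hc] ->]].
    by exists (m + n)%N; apply: homog_prec.
  rewrite -pi_prec E E' big_allpairs_dep /=.
  elim: s {hs E} => [|b s IH]; first by rewrite !big_nil; apply: dprec0l.
  rewrite !big_cons -IH [LHS]dprecDl; congr (_ + _).
  elim: s' {hs' E' IH} => [|c s' IH]; first by rewrite !big_nil; apply: dprec0r.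
  by rewrite !big_cons -IH; apply: dprecDr.
- move=> t [s [hs E]] t' [s' [hs' E']]; exists [seq b ≻ c | b <- s, c <- s']; split.
    move=> _ /allpairsP[[b c] /= [/hs[m hb] /hs'[n hc] ->]].
    by exists (m + n)%N; apply: homog_succ.
  rewrite -pi_succ E E' big_allpairs_dep /=.
  elim: s {hs E} => [|b s IH]; first by rewrite !big_nil; apply: dsucc0l.
  rewrite !big_cons -IH [LHS]dsuccDl; congr (_ + _).
  elim: s' {hs' E' IH} => [|c s' IH]; first by rewrite !big_nil; apply: dsucc0r.
  by rewrite !big_cons -IH; apply: dsuccDr.
Qed.

Lemma homog_unique m n (a : dend V) : homog m a -> homog n a -> m != n -> a = 0.
Proof.
by move=> /homog_pr/(_ m) + /homog_pr/(_ m) + /negPf mn; rewrite eqxx mn => ->.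
Qed.
End Grading.

Section Unital.
Variables (K : comPzRingType) (V : lmodType K).
Local Notation D := (cdend V).

(* K 1 ⊕ Dend(V)^ : the pair (c, u) stands for c 1 + u. *)
Definition udend := (K * D)%type.
HB.instance Definition _ := GRing.Zmodule.on udend.

Definition uone : udend := (1, 0).
Definition umul (a b : udend) : udend :=
  (a.1 * b.1, a.1 *: b.2 + b.1 *: a.2 + dmul a.2 b.2).

Fact umulA : associative umul.
Proof.
move=> [a u] [b v] [c w]; congr pair => /=; first exact: mulrA.
rewrite (dmulDr u (_ + _)) (dmulDr u (b *: w)) (dmulDl (_ + _)) (dmulDl (a *: v)).
rewrite !(dmulZl, dmulZr) dmulA.
rewrite (scalerDr a (_ + _)) (scalerDr a (b *: w)) (scalerDr c (_ + _)).
rewrite (scalerDr c (a *: v)) !scalerA.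
rewrite (mulrC c a) (mulrC c b).
move: (a * b *: w) (a * c *: v) (a *: _) (b * c *: u) (b *: _) (c *: _).
move: (dmul (dmul u v) w) => t7 t1 t2 t3 t4 t5 t6.
rewrite -!addrA; do 2 congr (_ + _); rewrite addrCA; congr (_ + _).
by rewrite [RHS]addrCA; congr (_ + _); rewrite addrCA.
Qed.
Fact umul1l : left_id uone umul.
Proof.
by move=> [c u]; rewrite /umul /= mul1r scale1r scaler0 dmul0l !addr0.
Qed.
Fact umul1r : right_id uone umul.
Proof.
by move=> [c u]; rewrite /umul /= mulr1 scale1r scaler0 dmul0r addr0 add0r.
Qed.
Fact umulDl : left_distributive umul +%R.
Proof.
move=> [a u] [b v] [c w]; congr pair => /=; first exact: mulrDl.
by rewrite dmulDl scalerDl scalerDr [RHS]addrACA; congr (_ + _); rewrite addrACA.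
Qed.
Fact umulDr : right_distributive umul +%R.
Proof.
move=> [a u] [b v] [c w]; congr pair => /=; first exact: mulrDr.
by rewrite dmulDr scalerDl (scalerDr a v) [RHS]addrACA; congr (_ + _); rewrite addrACA.
Qed.
HB.instance Definition _ :=
  GRing.Zmodule_isPzRing.Build udend umulA umul1l umul1r umulDl umulDr.

Definition uinj (u : D) : udend := (0, u).

(* a ≻ z with 1 ≻ z = z, and z ≺ b with z ≺ 1 = z *)
Definition usucc (a : udend) (z : D) : D := a.1 *: z + a.2 ≻ z.
Definition uprec (z : D) (b : udend) : D := b.1 *: z + z ≺ b.2.

Lemma usucc_precA a z b : uprec (usucc a z) b = usucc a (uprec z b).
Proof.
rewrite /uprec /usucc !(dprecDl, dsuccDr, dprecZl, dsuccZr) !scalerDr !scalerA.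
by rewrite dsucc_precA mulrC addrACA.
Qed.

(* The sum of w 0, w 1, ... when w n has no component in degrees <= n *)
Lemma homog_csum (w : nat -> D) d : homog d (\sum_(n < d) w n d).
Proof. by apply: (homog_sum (F := fun n => w n d)) => n _; apply: compP. Qed.
Definition csum (w : nat -> D) : D := CDend (homog_csum w).

Lemma comp_sum (w : nat -> D) m d :
  (\sum_(n < m) w n) d = \sum_(n < m) w n d.
Proof. by elim: m => [|m IH]; rewrite ?big_ord0 // !big_ord_recr /= IH. Qed.

Lemma csumE (w : nat -> D) : (forall n d, (d <= n)%N -> w n d = 0) ->
  forall d m, (d <= m)%N -> (\sum_(n < m) w n) d = csum w d.
Proof.
move=> w0 d; elim=> [|m IH]; rewrite leq_eqVlt => /predU1P[->|//].
- by rewrite comp_sum.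
- by rewrite comp_sum.
rewrite ltnS => dm; rewrite big_ord_recr /= w0 // addr0; exact: IH.
Qed.

(* z^{≺ n+1} and z^{≻ n+1} *)
Fixpoint prec_pow (z : D) n : D := if n is m.+1 then z ≺ prec_pow z m else z.
Fixpoint succ_pow (z : D) n : D := if n is m.+1 then succ_pow z m ≻ z else z.

Lemma prec_pow_low z n d : (d <= n)%N -> prec_pow z n d = 0.
Proof.
elim: n d => [|n IH] d dn /=.
  by move: dn; rewrite leqn0 => /eqP->; apply: homog_deg0; apply: compP.
rewrite big1 // => -[[|i] /= _] _.
  by rewrite (homog_deg0 (compP z 0)) dprec0l.
by rewrite IH ?dprec0r // leq_subLR; apply: leq_trans dn _; rewrite addSn ltnS leq_addl.
Qed.
Lemma succ_pow_low z n d : (d <= n)%N -> succ_pow z n d = 0.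
Proof.
elim: n d => [|n IH] d dn /=.
  by move: dn; rewrite leqn0 => /eqP->; apply: homog_deg0; apply: compP.
rewrite big1 // => -[i /=]; rewrite ltnS => id _.
have [->|ne] := eqVneq i d; first by rewrite subnn (homog_deg0 (compP z 0)) dsucc0r.
by rewrite IH ?dsucc0l // -ltnS; apply: leq_trans dn; rewrite ltn_neqAle ne.
Qed.

Definition eprec (z : D) : udend := 1 + uinj (csum (prec_pow z)).
Definition esucc (z : D) : udend := 1 + uinj (csum (succ_pow z)).
End Unital.

(* Main.v *)
(* Since e(z) = 1 + z ≺ e(z), and this equation determines e(z) degree by
   degree, it suffices to check it for e(x)e(y) with z the claimed argument.
   Expanding with the dendriform axioms,
     e(x)e(y) = 1 + x ≺ (e(x)e(y)) + (e(x) ≻ y) ≺ e(y),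
   and the last term equals (e(x) ≻ y ≺ e'(-x)) ≺ (e(x)e(y)) because ≺ is a
   right action of the associative product and e'(-x)e(x) = 1. The second
   equality is symmetric, with e'(z) = 1 + e'(z) ≻ z. *)
Require Import Defs.
From mathcomp Require Import all_boot all_order all_algebra.
Import GRing.Theory.
Local Open Scope ring_scope.

Section Exponentials.
Context {K : comPzRingType} {V : lmodType K}.
Implicit Types (u v z : cdend V) (p q : udend V).

Lemma comp0 z : z 0 = 0.
Proof. exact: homog_deg0 (compP z 0). Qed.

Lemma compD u v n : (u + v) n = u n + v n. Proof. by []. Qed.

(** This is [dprecA] extended to constant terms: since [dmul] is [≺] plus [≻], its two summands
    merge into one product. *)
Lemma uprecM z p q : uprec (uprec z p) q = uprec z (p * q).
Proof.
rewrite /uprec /= /dmul !(dprecDl, dprecDr, dprecZl, dprecZr) dprecA !scalerDr.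
by rewrite !scalerA [q.1 * _]mulrC -!addrA; congr (_ + _); rewrite addrCA.
Qed.

Lemma usuccM p q z : usucc p (usucc q z) = usucc (p * q) z.
Proof.
rewrite /usucc /= /dmul !(dsuccDl, dsuccDr, dsuccZl, dsuccZr) -dsuccA !scalerDr.
by rewrite !scalerA -!addrA.
Qed.

Lemma uprecDl u v p : uprec (u + v) p = uprec u p + uprec v p.
Proof. by rewrite /uprec dprecDl scalerDr addrACA. Qed.

Lemma usuccDr p u v : usucc p (u + v) = usucc p u + usucc p v.
Proof. by rewrite /usucc dsuccDr scalerDr addrACA. Qed.

Lemma uprec_unital z u : uprec z (1 + uinj u) = z + z ≺ u.
Proof. by rewrite /uprec /= addr0 scale1r add0r. Qed.

Lemma usucc_unital u z : usucc (1 + uinj u) z = z + u ≻ z.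
Proof. by rewrite /usucc /= addr0 scale1r add0r. Qed.

(** Grouping [v] with [u ≻ v] leaves [u] and [u ≺ v], which combine into [uprec u (1 + uinj v)]. *)
Lemma mul_unital u v :
  (1 + uinj u) * (1 + uinj v) = 1 + uinj (u + usucc (1 + uinj u) v + u ≺ v).
Proof.
rewrite usucc_unital; congr pair => /=.
  by rewrite !addr0 mulr1.
by rewrite !add0r addr0 !scale1r /dmul [v + u]addrC -!addrA [_ ≻ _ + _]addrC.
Qed.

Lemma csum_prec_pow z : csum (prec_pow z) = z + z ≺ csum (prec_pow z).
Proof.
apply: cdendP => d; have low n k := @prec_pow_low _ _ z n k.
(* Truncating at [d.+1] terms leaves [d] powers once [z] is split off, still enough for every degree
   up to [d]. *)
rewrite -(csumE low (leqnSn d)) big_ord_recl 2!compD; congr (_ + _).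
rewrite -(dprec_sumr _ (prec_pow z)) /=; apply: eq_bigr => i _.
by rewrite (csumE low) // leq_subr.
Qed.

Lemma csum_succ_pow z : csum (succ_pow z) = z + csum (succ_pow z) ≻ z.
Proof.
apply: cdendP => d; have low n k := @succ_pow_low _ _ z n k.
rewrite -(csumE low (leqnSn d)) big_ord_recl 2!compD; congr (_ + _).
rewrite -(dsucc_suml _ (succ_pow z)) /=; apply: eq_bigr => i _.
by rewrite (csumE low) // -ltnS.
Qed.

(** As [z] has no degree 0 part, degree [d] of [z ≺ u] only involves [u] in degrees below [d]. *)
Lemma prec_fix_unique z u v : u = z + z ≺ u -> v = z + z ≺ v -> u = v.
Proof.
move=> uE vE; apply: cdendP; elim/ltn_ind => d IH.
rewrite uE vE !compD; congr (_ + _); apply: eq_bigr => -[[|i] /= id] _.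
  by rewrite comp0 !dprec0l.
by rewrite IH // ltn_subrL (leq_ltn_trans (leq0n i) id).
Qed.

Lemma succ_fix_unique z u v : u = z + u ≻ z -> v = z + v ≻ z -> u = v.
Proof.
move=> uE vE; apply: cdendP; elim/ltn_ind => d IH.
rewrite uE vE !compD; congr (_ + _); apply: eq_bigr => -[i /=].
(* At [i = d] the right factor is [z 0 = 0]; otherwise induction applies. *)
rewrite ltnS leq_eqVlt => /predU1P[-> _|id _]; last by rewrite IH.
by rewrite subnn comp0 !dsucc0r.
Qed.

Lemma eprecE z : eprec z = 1 + uinj (uprec z (eprec z)).
Proof. by rewrite uprec_unital -csum_prec_pow. Qed.

Lemma esuccE z : esucc z = 1 + uinj (usucc (esucc z) z).
Proof. by rewrite usucc_unital -csum_succ_pow. Qed.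

(** This recognises a product as an exponential once it is written as [1 + uinj u]. *)
Lemma eprec_unique z u : u = uprec z (1 + uinj u) -> 1 + uinj u = eprec z.
Proof.
rewrite uprec_unital => uE; congr (1 + uinj _).
exact: prec_fix_unique _ _ _ uE (csum_prec_pow z).
Qed.

Lemma esucc_unique z u : u = usucc (1 + uinj u) z -> 1 + uinj u = esucc z.
Proof.
rewrite usucc_unital => uE; congr (1 + uinj _).
exact: succ_fix_unique _ _ _ uE (csum_succ_pow z).
Qed.

(** Expanding the product leaves, besides 1, the term [p ≻ z ≺ q] and its opposite, which cancel. *)
Lemma esuccN_mul_eprec z : esucc (- z) * eprec z = 1.
Proof.
set p := esucc (- z); set q := eprec z.
have pz : usucc p z = - (usucc p (- z)).
  by apply/eqP; rewrite -addr_eq0 -usuccDr subrr /usucc scaler0 dsucc0r addr0.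
rewrite [p]esuccE [q]eprecE mul_unital -/p -/q -esuccE -/p -usucc_precA pz.
rewrite addrAC -uprec_unital -eprecE -/q -uprecDl subrr.
by rewrite /uprec dprec0l scaler0 addr0 /uinj; apply: addr0.
Qed.

Lemma eprec_mul u v :
  eprec u * eprec v = eprec (u + uprec (usucc (eprec u) v) (esucc (- u))).
Proof.
set p := eprec u; set q := eprec v; set w := u + _.
have E : p * q = 1 + uinj (uprec w (p * q)).
  (* The factor [esucc (- u)] in [w] cancels [p], leaving [q] alone. *)
  rewrite uprecDl uprecM mulrA esuccN_mul_eprec mul1r.
  rewrite {1}[p]eprecE {1}[q]eprecE mul_unital -/p -/q -eprecE -/p.
  by rewrite addrAC -uprec_unital -eprecE uprecM usucc_precA.
by rewrite E; apply: eprec_unique; rewrite -E.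
Qed.

Lemma esucc_mul u v :
  esucc u * esucc v = esucc (uprec (usucc (eprec (- v)) u) (esucc v) + v).
Proof.
set p := esucc u; set q := esucc v; set w := _ + v.
have qN : q * eprec (- v) = 1 by rewrite -(esuccN_mul_eprec (- v)) opprK.
have E : p * q = 1 + uinj (usucc (p * q) w).
  (* Moving [esucc v] outward first lets [q] meet [eprec (- v)] and cancel. *)
  rewrite usuccDr usucc_precA usuccM -mulrA qN mulr1 -usucc_precA -usuccM.
  rewrite {1}[p]esuccE {1}[q]esuccE mul_unital -/p -/q -esuccE -/p.
  by rewrite addrAC -uprec_unital -esuccE.
by rewrite E; apply: esucc_unique; rewrite -E.
Qed.

Lemma cgenN (x : V) : cgen (- x) = - cgen x.
Proof. exact: linear_funN (@cgen_linear K V). Qed.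

End Exponentials.

Theorem theorem3p1 (K : comPzRingType) (V : lmodType K) (x y : V) :
  eprec (cgen x) * eprec (cgen y) =
    eprec (cgen x + uprec (usucc (eprec (cgen x)) (cgen y)) (esucc (cgen (- x)))) /\
  esucc (cgen x) * esucc (cgen y) =
    esucc (uprec (usucc (eprec (cgen (- y))) (cgen x)) (esucc (cgen y)) + cgen y).
Proof. by rewrite !cgenN; split; [apply: eprec_mul | apply: esucc_mul]. Qed.
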